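(* Let $n\ge 1$. There are exactly $\binom{n}{3}+\binom{n-2}{3}$ butterflies in the Hasse diagram of $(\mathfrak{B}_n,\le)$. Furthermore, each Hasse edge $\pi\vartriangleleft\sigma$ is in either one or two butterflies. The edge $\pi\vartriangleleft\sigma$ is in a unique butterfly if and only if there is some coordinate $i\in\{1,2,3,4\}$ such that $\ell_i(\pi)=\ell_i(\sigma)=1$.
   Context: $\mathfrak{S}_n$ is the set of permutations of $[n]=\{1,\dots,n\}$, in one-line notation. A reduction of $\omega\in\mathfrak{S}_n$ interchanges $\omega(i)$ and $\omega(j)$ for some $i<j$ with $\omega(i)>\omega(j)$. Bruhat order: $\pi\le\sigma$ if $\pi$ is obtained from $\sigma$ by a (possibly empty) sequence of reductions. $\mathfrak{B}_n\subseteq\mathfrak{S}_n$ is the set of bigrassmannian permutations (both $\omega$ and $\omega^{-1}$ have exactly one descent), with the order inherited from Bruhat order; equivalently $\omega=1\cdots a\,(b+1)\cdots c\,(a+1)\cdots b\,(c+1)\cdots n$ for a unique triple $0\le a<b<c\le n$. The length vector of such an element is $(\ell_1,\ell_2,\ell_3,\ell_4)=(a+1,b-a,c-b,n+1-c)$. $\pi\vartriangleleft\sigma$ means $\sigma$ covers $\pi$ in $\mathfrak{B}_n$ ($\pi<\sigma$ with no element of $\mathfrak{B}_n$ strictly between). The poset $(\mathfrak{B}_n,\le)$ is ranked with rank function $\lambda(\sigma)=\ell_2(\sigma)+\ell_3(\sigma)-2$. A butterfly is a set $\{\pi_1,\pi_2,\sigma_1,\sigma_2\}\subseteq\mathfrak{B}_n$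 of four distinct elements with $\pi_1,\pi_2$ of the same rank $k$, $\sigma_1,\sigma_2$ of rank $k+1$, and $\pi_i\vartriangleleft\sigma_j$ for all $i,j\in\{1,2\}$. An edge $\pi\vartriangleleft\sigma$ is in a butterfly if $\pi$ and $\sigma$ both belong to it. Convention: $\binom{m}{3}=0$ for integers $m<3$. *)

(* Defs.v *)
From mathcomp Require Import all_boot all_fingroup.

Set Implicit Arguments.
Unset Strict Implicit.
Unset Printing Implicit Defensive.

(* Permutations of {1, ..., n} are elements of 'S_n, acting on {0, ..., n-1}. *)

(* In MathComp (s * t) x = t (s x), so tperm i j * w is w with its values at
   the positions i and j interchanged. *)
Definition reduction n : rel 'S_n := fun w v =>
  [exists i : 'I_n, exists j : 'I_n,
    [&& i < j, w j < w i & v == (tperm i j * w)%g]].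

Definition bruhat_le n (p s : 'S_n) : bool := connect (@reduction n) s p.

Definition bruhat_lt n (p s : 'S_n) : bool := (p != s) && bruhat_le p s.

Definition descents n (w : 'S_n) : {set 'I_n} :=
  [set i : 'I_n | [exists j : 'I_n, (j == i.+1 :> nat) && (w j < w i)]].

Definition bigrassmannian n (w : 'S_n) : bool :=
  (#|descents w| == 1) && (#|descents (w^-1)%g| == 1).

Definition one_line n (w : 'S_n) : seq nat := [seq (w i).+1 | i <- enum 'I_n].

Definition block_form n (w : 'S_n) (a b c : nat) : bool :=
  [&& a < b, b < c, c <= n &
    one_line w == iota 1 a ++ iota b.+1 (c - b) ++ iota a.+1 (b - a)
                  ++ iota c.+1 (n - c)].

(* Coordinates l_1, ..., l_4 are indexed by 0, ..., 3.  The triple (a, b, c) is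
   unique, and exists exactly when w is bigrassmannian; other permutations get
   a dummy value. *)
Definition length_vector n (w : 'S_n) : 4.-tuple nat :=
  if [pick t : 'I_n.+1 * 'I_n.+1 * 'I_n.+1 | block_form w t.1.1 t.1.2 t.2]
     is Some (a, b, c)
  then [tuple a.+1; b - a; c - b; n.+1 - c]
  else [tuple 0; 0; 0; 0].

Definition ell n (w : 'S_n) (i : 'I_4) : nat := tnth (length_vector w) i.

Definition bg_rank n (w : 'S_n) : nat :=
  ell w (@Ordinal 4 1 isT) + ell w (@Ordinal 4 2 isT) - 2.

Definition bg_covers n (p s : 'S_n) : bool :=
  [&& bigrassmannian p, bigrassmannian s, bruhat_lt p s &
    ~~ [exists q : 'S_n,
          [&& bigrassmannian q, bruhat_lt p q & bruhat_lt q s]]].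

Definition butterfly n (B : {set 'S_n}) : bool :=
  [exists p1 : 'S_n, exists p2 : 'S_n, exists s1 : 'S_n, exists s2 : 'S_n,
    [&& B == [set p1; p2; s1; s2], uniq [:: p1; p2; s1; s2],
        bg_rank p1 == bg_rank p2,
        bg_rank s1 == (bg_rank p1).+1, bg_rank s2 == (bg_rank p1).+1,
        bg_covers p1 s1, bg_covers p1 s2, bg_covers p2 s1 & bg_covers p2 s2]].

Definition butterflies n : {set {set 'S_n}} := [set B | butterfly B].

Definition edge_butterflies n (p s : 'S_n) : {set {set 'S_n}} :=
  [set B in butterflies n | (p \in B) && (s \in B)].

(* Main.v *)
Require Import Defs.
From mathcomp Require Import all_boot all_fingroup.
From mathcomp Require Import zify.

Set Implicit Arguments.
Unset Strict Implicit.
Unset Printing Implicit Defensive.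

(* Encode a bigrassmannian permutation by its length vector l.  By the rank
   criterion for Bruhat order, pi <= sigma means that l_2 and l_3 weakly
   increase and l_1 and l_4 weakly decrease from pi to sigma, so the covers are
   the moves l + e_i - e_j with i in {2, 3} and j in {1, 4}.  Hence a butterfly is
   either {m + e_1, ..., m + e_4} for a positive vector m with sum n + 1, or
   {m + (1,1,1,1) - e_i | i = 1, ..., 4} for a positive vector m with sum n - 1;
   there are C(n, 3) and C(n - 2, 3) such vectors.  A cover from l to l' lies in
   the butterfly of the first kind with m = min(l, l'), and in one of the second
   kind exactly when max(l, l') - (1,1,1,1) is positive. *)

(** * The rank criterion for Bruhat order *)

(** The counting function of the rank criterion; comparing it at all corners [(p, q)] turns out to
    characterise Bruhat order. *)
Definition rk n (w : 'S_n) (p q : nat) : nat :=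
  #|[set i : 'I_n | (i < p) && (q <= w i)]|.

Lemma rk_sum n (w : 'S_n) p q : rk w p q = \sum_(k < n) ((k < p) && (q <= w k)).
Proof.
rewrite /rk cardsE -sum1_card big_mkcond /=; apply: eq_bigr => k _.
by rewrite unfold_in; case: (_ && _).
Qed.

(** Only the entries at [i] and [j] change, so a unit is lost exactly when [p] separates the two
    positions and [q] separates the two values. Writing this with an addition avoids truncated
    subtraction. *)
Lemma rk_reduction n (w : 'S_n) (i j : 'I_n) p q : i < j -> w j < w i ->
  rk (tperm i j * w)%g p q + ((i < p <= j) && (w j < q <= w i)) = rk w p q.
Proof.
move=> ij wji; have ji : j != i by rewrite neq_ltn ij orbT.
rewrite !rk_sum (bigD1 i) //= (bigD1 j) //= [in RHS](bigD1 i) //= [in RHS](bigD1 j) //=.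
rewrite !permM tpermL tpermR.
rewrite [X in _ + (_ + X) + _ = _](_ : _ =
    \sum_(k < n | (k != i) && (k != j)) ((k < p) && (q <= w k))); last first.
  by apply: eq_bigr => k /andP [ki kj]; rewrite permM tpermD // eq_sym.
set S := \sum_(_ < _ | _) _; move: S => S.
by case: (ltnP i p) => ?; case: (leqP q (w i)) => ?; case: (leqP q (w j)) => ?;
  case: (ltnP j p) => ? /=; lia.
Qed.

Lemma bruhat_le_rk n (v w : 'S_n) p q : bruhat_le v w -> rk v p q <= rk w p q.
Proof.
case/connectP => s; elim: s w => [|u s IHs] w /=; first by move=> _ ->.
case/andP=> /existsP [i /existsP [j /and3P [ij wji /eqP ->]]] us vE.
by rewrite -(rk_reduction p q ij wji); apply: leq_trans (leq_addr _ _); apply: IHs.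
Qed.

(* At the first position i where v and w differ, the rank condition forces
   v i < w i; swapping w i with the first later entry of w lying in
   [v i, w i) keeps the rank condition. *)
Lemma rk_le_reduction n (v w : 'S_n) :
    (forall p q, rk v p q <= rk w p q) -> v != w ->
  exists i j : 'I_n, [/\ i < j, w j < w i &
    forall p q, rk v p q <= rk (tperm i j * w)%g p q].
Proof.
move=> le_vw neq_vw.
have [i vwi mini] : exists2 i : 'I_n, v i != w i & forall k : 'I_n, k < i -> v k = w k.
  have [i0 i0P] : exists i, v i != w i.
    apply/existsP; apply: contraNT neq_vw; rewrite negb_exists => /forallP eq_vw.
    by apply/eqP/permP => k; apply/eqP; rewrite -[_ == _]negbK.
  case: (@arg_minnP _ i0 (fun k => v k != w k) (@nat_of_ord n) i0P) => i vwi mini.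
  exists i => // k ki; apply/eqP; apply: contraTT ki => /mini.
  by rewrite -leqNgt.
(* Otherwise [v] would count more than [w] at the corner [(i + 1, v i)], since the two agree before
   [i]. *)
have lt_vwi : v i < w i.
  rewrite ltn_neqAle vwi /=; rewrite leqNgt; apply/negP => lt_wvi.
  have := le_vw i.+1 (v i); rewrite leqNgt => /negP; apply.
  rewrite /rk; apply: proper_card; apply/properP; split.
    apply/subsetP => k; rewrite !inE ltnS leq_eqVlt => /andP [/orP [/eqP/val_inj ->|ki]].
      by rewrite leqNgt lt_wvi.
    by rewrite (mini k ki) => ->; rewrite ki orbT.
  by exists i; rewrite !inE ?ltnSn ?leqnn //= -ltnNge.
(* The position of the value [v i] in [w] is a candidate: it differs from [i], and it cannot precede
   [i], where [v] and [w] agree. *)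
have [j0 j0P] : exists j : 'I_n, (i < j) && (v i <= w j < w i).
  exists ((w^-1)%g (v i)); rewrite permKV leqnn lt_vwi /= andbT.
  set j := (w^-1)%g (v i); rewrite ltnNge leq_eqVlt; apply/negP => /orP [/eqP/val_inj ji|ji].
    by move: vwi; rewrite -{2}ji permKV eqxx.
  have := mini _ ji; rewrite permKV => /perm_inj jE.
  by move: ji; rewrite jE ltnn.
case: (@arg_minnP _ j0 (fun k => (i < k) && (v i <= w k < w i)) (@nat_of_ord n) j0P)
  => j /and3P [ij vij wji] minj.
exists i, j; split=> // p q.
have := rk_reduction p q ij wji; set r := rk (tperm _ _ * w)%g p q.
case: (boolP (_ && _)) => [|_]; last by rewrite addn0 => ->; apply: le_vw.
move=> /andP [/andP [ip pj] /andP [wjq qwi]] rE.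
(* Inside the rectangle where the swap lowers the count, strictness comes from comparing level [q]
   with level [v i]. By minimality of [j], the positions before [p] whose [w]-value lies in
   [[v i, q)] all precede [i], so they count for [v] as well, whereas [i] counts for [v] only. *)
suff: rk v p q < rk w p q by rewrite -rE addn1 ltnS.
have split_rk (u : 'S_n) : rk u p (v i) =
    rk u p q + #|[set k : 'I_n | (k < p) && (v i <= u k < q)]|.
  rewrite /rk -cardsUI [X in _ = _ + X](_ : _ = 0) ?addn0; last first.
    by apply/eqP; rewrite cards_eq0; apply/eqP/setP => k; rewrite !inE; lia.
  by apply: eq_card => k; rewrite !inE; have := leq_trans vij (ltnW wjq); lia.
have := le_vw p (v i); rewrite !split_rk => le_s.
suff : #|[set k : 'I_n | (k < p) && (v i <= w k < q)]| <
       #|[set k : 'I_n | (k < p) && (v i <= v k < q)]| by lia.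
apply: proper_card; apply/properP; split.
  apply/subsetP => k; rewrite !inE; case: (ltngtP k i) => [ki|ik|/val_inj ->].
  - by rewrite (mini k ki).
  - move=> /and3P [kp vk kq]; have := minj k; rewrite ik vk (leq_trans kq qwi) /=.
    by move=> /(_ isT); lia.
  - by lia.
by exists i; rewrite !inE; lia.
Qed.

Lemma rk_le_bruhat n (v w : 'S_n) :
  (forall p q, rk v p q <= rk w p q) -> bruhat_le v w.
Proof.
have [m] := ubnP (\sum_(p < n.+1) \sum_(q < n.+1) rk w p q).
elim: m w => // m IHm w; rewrite ltnS => le_m le_vw.
have [->|neq_vw] := eqVneq v w; first exact: connect0.
have [i [j [ij wji le_v]]] := rk_le_reduction le_vw neq_vw.
apply: (@connect_trans _ _ (tperm i j * w)%g).
  apply: connect1; apply/existsP; exists i; apply/existsP; exists j.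
  by rewrite ij wji eqxx.
apply: IHm => //; apply: leq_trans le_m.
have le_r p q : rk (tperm i j * w)%g p q <= rk w p q.
  by rewrite -(rk_reduction p q ij wji) leq_addr.
(* The swap certainly loses a unit at the corner [(i + 1, w i)], so the total over all corners
   drops. *)
have i1 : i.+1 < n.+1 by rewrite ltnS ltn_ord.
have wi1 : w i < n.+1 by rewrite ltnS ltnW // ltn_ord.
rewrite (bigD1 (Ordinal i1)) //= [ltnRHS](bigD1 (Ordinal i1)) //=.
rewrite -addSn leq_add //; last by apply: leq_sum => p _; apply: leq_sum => q _.
rewrite (bigD1 (Ordinal wi1)) //= [ltnRHS](bigD1 (Ordinal wi1)) //=.
rewrite -addSn leq_add //; last by apply: leq_sum => q _.
by rewrite -(rk_reduction _ _ ij wji); lia.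
Qed.

Lemma bruhat_leP n (v w : 'S_n) :
  reflect (forall p q, rk v p q <= rk w p q) (bruhat_le v w).
Proof.
apply: (iffP idP); last exact: rk_le_bruhat.
by move=> le_vw p q; apply: bruhat_le_rk.
Qed.

(** * Block forms *)

(** The block one-line notation on 0-based positions. The block of larger values has length [c - b]
    and comes first, so the unique descent falls just before position [a + (c - b)]. *)
Definition block_fun (a b c i : nat) : nat :=
  if i < a then i else if i < a + (c - b) then i + (b - a)
  else if i < c then i - (c - b) else i.

Lemma size_one_line n (w : 'S_n) : size (one_line w) = n.
Proof. by rewrite size_map size_enum_ord. Qed.

Lemma nth_one_line n (w : 'S_n) (i : 'I_n) : nth 0 (one_line w) i = (w i).+1.
Proof. by rewrite (nth_map i) ?size_enum_ord // nth_ord_enum. Qed.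

Lemma block_formP n (w : 'S_n) a b c :
  reflect ([/\ a < b, b < c, c <= n & forall i, w i = block_fun a b c i :> nat])
          (block_form w a b c).
Proof.
rewrite /block_form; apply: (iffP and4P) => -[ab bc cn].
  move/eqP=> wE; split=> // i; apply: succn_inj.
  rewrite -nth_one_line wE !nth_cat !size_iota /block_fun.
  case: ltnP => ia; first by rewrite nth_iota.
  have -> : (i - a < c - b) = (i < a + (c - b)) by lia.
  case: ltnP => ib; first by rewrite nth_iota; lia.
  have -> : (i - a - (c - b) < b - a) = (i < c) by lia.
  case: ltnP => ic; first by rewrite nth_iota; lia.
  by rewrite nth_iota; have := ltn_ord i; lia.
move=> wE; split=> //; apply/eqP; apply: (@eq_from_nth nat 0) => [|k].
  by rewrite size_one_line !size_cat !size_iota; lia.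
rewrite size_one_line => kn.
rewrite (nth_one_line w (Ordinal kn)) wE /= !nth_cat !size_iota /block_fun.
case: ltnP => ia; first by rewrite nth_iota.
have -> : (k - a < c - b) = (k < a + (c - b)) by lia.
case: ltnP => ib; first by rewrite nth_iota; lia.
have -> : (k - a - (c - b) < b - a) = (k < c) by lia.
case: ltnP => ic; first by rewrite nth_iota; lia.
by rewrite nth_iota; lia.
Qed.

Lemma block_form_inj n (v w : 'S_n) a b c :
  block_form v a b c -> block_form w a b c -> v = w.
Proof.
move=> /block_formP [_ _ _ vE] /block_formP [_ _ _ wE].
by apply/permP => i; apply: val_inj; rewrite /= vE wE.
Qed.

(** The parameters can be read off the permutation: [a] is the first moved point, [c - 1] the last
    one, and [b] the image of [a]. *)
Lemma block_form_uniq n (w : 'S_n) a b c a' b' c' :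
  block_form w a b c -> block_form w a' b' c' -> [/\ a = a', b = b' & c = c'].
Proof.
move=> /block_formP [ab bc cn wE] /block_formP [ab' bc' cn' wE'].
have eq_f i : i < n -> block_fun a b c i = block_fun a' b' c' i.
  by move=> lt_i; have := wE (Ordinal lt_i); rewrite wE'.
have first_moved x y z i : x < y -> y < z -> block_fun x y z i != i -> x <= i.
  by move=> _ _; rewrite leqNgt; apply: contra => ix; rewrite /block_fun ix.
have last_moved x y z i : x < y -> y < z -> block_fun x y z i != i -> i < z.
  by move=> xy yz; rewrite ltnNge; apply: contra => zi;
    rewrite /block_fun; do ![case: ifP => ?]; lia.
have f_first x y z : x < y -> y < z -> block_fun x y z x = y.
  by rewrite /block_fun => *; do ![case: ifP => ?]; lia.
have f_last x y z : x < y -> y < z -> block_fun x y z z.-1 = y.-1.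
  by rewrite /block_fun => *; do ![case: ifP => ?]; lia.
have aE : a = a'.
  have := first_moved a' b' c' a ab' bc'; rewrite -eq_f ?f_first //; last by lia.
  by have := first_moved a b c a' ab bc; rewrite eq_f ?f_first //; lia.
have cE : c = c'.
  have := last_moved a' b' c' c.-1 ab' bc'; rewrite -eq_f ?f_last //; last by lia.
  by have := last_moved a b c c'.-1 ab bc; rewrite eq_f ?f_last //; lia.
split=> //; have := eq_f a; rewrite f_first // {2}aE f_first //; lia.
Qed.

Lemma ex_block_form n a b c : a < b -> b < c -> c <= n ->
  exists w : 'S_n, block_form w a b c.
Proof.
move=> ab bc cn.
have f_lt (i : 'I_n) : block_fun a b c i < n.
  by rewrite /block_fun; have := ltn_ord i; do ![case: ifP => ?]; lia.
have f_inj : injective (fun i : 'I_n => Ordinal (f_lt i)).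
  move=> i j /(congr1 (@nat_of_ord n)) /=; rewrite /block_fun => fij; apply: val_inj => /=.
  by move: fij; do ![case: ifP => ?] => *; lia.
exists (perm f_inj); apply/block_formP; split=> // i.
by rewrite permE.
Qed.

(** * The rank function of a block permutation *)

Lemma rk_minn n (w : 'S_n) p q : rk w p q = rk w (minn p n) q.
Proof.
by apply: eq_card => i; rewrite !inE leq_min ltn_ord andbT.
Qed.

(** Truncated [p - q] is the count for the identity; the rest is a correction by a minimum of four
    terms. Each term is monotone in just one of [a], [c], [b - a], [c - b], which makes comparing
    two block permutations immediate. *)
Definition block_rk (a b c p q : nat) : nat :=
  if p < q then minn (minn (p - a) (c - q)) (minn (c - b) (p + (b - a) - q))
  else (p - q) + minn (minn (q - a) (c - p)) (minn (b - a) (q + (c - b) - p)).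

Lemma block_rk_outer a b c p q : (p <= a) || (c <= p) -> block_rk a b c p q = p - q.
Proof.
rewrite /block_rk => pac; case: ifP => pq.
  have [-> | ->] : p - a = 0 \/ c - q = 0 by lia.
  - by rewrite !min0n; lia.
  - by rewrite minn0 !min0n; lia.
have [-> | ->] : q - a = 0 \/ c - p = 0 by lia.
- by rewrite !min0n addn0.
- by rewrite minn0 !min0n addn0.
Qed.

(** In this range of [p] two of the four terms are redundant. The summands count the fixed values
    below [a] and the values of the first moved block placed so far. *)
Lemma block_rk_left a b c p q : a < b -> b < c -> a <= p -> p <= a + (c - b) ->
  block_rk a b c p q = (a - q) + minn (p - a) (p + (b - a) - q).
Proof.
rewrite /block_rk => ab bc ap pm; case: ifP => pq.
  rewrite minnACA; have /minn_idPl -> : p - a <= c - b by lia.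
  have /minn_idPr -> : p + (b - a) - q <= c - q by lia.
  lia.
rewrite (minnC (b - a)) minnACA.
have /minn_idPl -> : q - a <= q + (c - b) - p by lia.
have /minn_idPr -> : b - a <= c - p by lia.
lia.
Qed.

Lemma block_rk_right a b c p q : a < b -> b < c -> a + (c - b) <= p -> p <= c ->
  block_rk a b c p q = (p - (c - b) - q) + minn (c - q) (c - b).
Proof.
rewrite /block_rk => ab bc mp pc; case: ifP => pq.
  rewrite minnACA; have /minn_idPl -> : c - q <= p + (b - a) - q by lia.
  have /minn_idPr -> : c - b <= p - a by lia.
  lia.
rewrite (minnC (b - a)) minnACA; have /minn_idPr -> : q + (c - b) - p <= q - a by lia.
have /minn_idPl -> : c - p <= b - a by lia.
lia.
Qed.

(** The ranges of the closed forms share their endpoints, so [p] and [p + 1] always fall under a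
    common form and the increment is linear arithmetic. *)
Lemma block_rkS a b c p q : a < b -> b < c ->
  block_rk a b c p.+1 q = block_rk a b c p q + (q <= block_fun a b c p).
Proof.
move=> ab bc; rewrite /block_fun.
have [pa|ap] := ltnP p a.
  by rewrite !block_rk_outer ?pa ?(ltnW pa) //; lia.
have [pm|mp] := ltnP p (a + (c - b)).
  by rewrite !block_rk_left ?(ltnW pm) ?(leqW ap) //; lia.
have [pc|cp] := ltnP p c.
  rewrite !block_rk_right ?(ltnW pc) ?(leqW mp) //; lia.
by rewrite !block_rk_outer ?cp ?(leqW cp) ?orbT //; lia.
Qed.

Lemma rk_block n (w : 'S_n) a b c p q : block_form w a b c -> p <= n ->
  rk w p q = block_rk a b c p q.
Proof.
move=> /block_formP [ab bc cn wE]; elim: p => [|p IHp] pn.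
  rewrite block_rk_outer // sub0n; apply/eqP.
  by rewrite cards_eq0; apply/eqP/setP => i; rewrite !inE.
rewrite block_rkS // -IHp ?(ltnW pn) // !rk_sum.
rewrite (bigD1 (Ordinal pn)) //= [in RHS](bigD1 (Ordinal pn)) //= ltnn add0n wE addnC.
rewrite ltnSn; congr (_ + _); apply: eq_bigr => i ip.
have {}ip : i != p :> nat by apply: contraNneq ip => /= ip; apply/eqP/val_inj.
by rewrite ltnS leq_eqVlt (negPf ip).
Qed.

(** One well-chosen corner yields all four inequalities; conversely, each term of [block_rk] is
    monotone in its parameter. *)
Lemma block_leP n (v w : 'S_n) a b c a' b' c' :
  block_form v a b c -> block_form w a' b' c' ->
  bruhat_le v w = [&& a' <= a, c <= c', b - a <= b' - a' & c - b <= c' - b'].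
Proof.
move=> fv fw; have /block_formP [ab bc cn _] := fv.
have /block_formP [ab' bc' cn' _] := fw.
apply/bruhat_leP/and4P => [le_vw|[le_a le_c le_2 le_3] p q].
  (* At this corner [v] counts its whole first moved block, the values [b, ..., c - 1]. *)
  have pn : a + (c - b) <= n by lia.
  have := le_vw (a + (c - b)) b; rewrite (rk_block _ fv pn) (rk_block _ fw pn).
  have -> : block_rk a b c (a + (c - b)) b = c - b.
    by rewrite block_rk_left ?leq_addr //; lia.
  have [le_a'|lt_a'] := leqP (a + (c - b)) a'; first by rewrite block_rk_outer ?le_a' //; lia.
  have [le_c'|lt_c'] := leqP c' (a + (c - b)); first by rewrite block_rk_outer ?le_c' ?orbT //; lia.
  have [le_m|lt_m] := leqP (a + (c - b)) (a' + (c' - b')).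
    by rewrite block_rk_left ?(ltnW lt_a') // => ?; split; lia.
  by rewrite block_rk_right ?(ltnW lt_c') ?(ltnW lt_m) // => ?; split; lia.
(* The formula [block_rk] describes the count only for [p <= n], so [p] is first cut off at [n]. *)
rewrite rk_minn [leqRHS]rk_minn.
rewrite (rk_block _ fv (geq_minr _ _)) (rk_block _ fw (geq_minr _ _)).
by rewrite /block_rk; case: ifP => _; rewrite ?leq_add2l !leq_min !geq_min; lia.
Qed.

(** * Bigrassmannian permutations *)

Lemma mem_one_line n (w : 'S_n) x : (x \in one_line w) = (0 < x <= n).
Proof.
apply/mapP/andP => [[i _ ->]|]; first by rewrite ltn_ord.
case: x => [[]//|x [_ xn]]; exists ((w^-1)%g (Ordinal xn)); first by rewrite mem_enum.
by rewrite permKV.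
Qed.

Lemma uniq_one_line n (w : 'S_n) : uniq (one_line w).
Proof.
by rewrite map_inj_uniq ?enum_uniq // => i j [] /val_inj/perm_inj.
Qed.

Lemma descentP n (w : 'S_n) (i j : 'I_n) : j = i.+1 :> nat ->
  (i \in descents w) = (w j < w i).
Proof.
move=> ji; rewrite inE; apply/existsP/idP => [[k /andP [/eqP ki]]|ltw].
  by have -> : k = j by apply: val_inj; rewrite /= ki ji.
by exists j; rewrite ji eqxx.
Qed.

(** Inversion exchanges the lengths of the two moved blocks; hence the descent count for [w] also
    serves for its inverse. *)
Lemma block_form_inv n (w : 'S_n) a b c :
  block_form w a b c -> block_form (w^-1)%g a (a + (c - b)) c.
Proof.
move=> /block_formP [ab bc cn wE]; apply/block_formP; split; try lia.
move=> i; have := wE ((w^-1)%g i); rewrite permKV /block_fun.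
by do ![case: ifP => ?] => *; lia.
Qed.

Lemma block_form_descents n (w : 'S_n) a b c :
  block_form w a b c -> #|descents w| = 1.
Proof.
move=> /block_formP [ab bc cn wE].
have dn : (a + (c - b)).-1 < n by lia.
suff -> : descents w = [set Ordinal dn] by rewrite cards1.
apply/setP => i; rewrite in_set1 -val_eqE /=.
have [iN|iN] := ltnP i.+1 n.
  rewrite (@descentP _ _ _ (Ordinal iN)) // !wE /= /block_fun.
  by do ![case: ifP => ?]; lia.
rewrite inE [RHS](_ : _ = false); last by lia.
by apply/negbTE/existsPn => j; have := ltn_ord j; lia.
Qed.

Lemma sorted_ltn_iota2 m p k l : m + p <= k -> sorted ltn (iota m p ++ iota k l).
Proof.
move=> mpk; rewrite (sorted_pairwise ltn_trans) pairwise_cat.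
rewrite -!(sorted_pairwise ltn_trans) !iota_ltn_sorted !andbT.
by apply/allrelP => x y; rewrite !mem_iota; lia.
Qed.

(** The descent [d] of [w] cuts the one-line notation into two increasing runs [l] and [r]. The
    descent [e] of the inverse marks the only place where, going up through the values, one passes
    from [r] to [l]. So the 0-based values in [l] are those below [a] and those in [(e, c)], which
    determines both runs. *)
Lemma bigrassmannian_block n (w : 'S_n) :
  bigrassmannian w -> exists a b c, block_form w a b c.
Proof.
case/andP => /cards1P [d dE] /cards1P [e eE].
have [d1 d1E wd] : exists2 d1 : 'I_n, d1 = d.+1 :> nat & w d1 < w d.
  have := set11 d; rewrite -dE inE => /existsP [j /andP [/eqP]]; by exists j.
have [e1 e1E we] : exists2 e1 : 'I_n, e1 = e.+1 :> nat & (w^-1)%g e1 < (w^-1)%g e.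
  have := set11 e; rewrite -eE inE => /existsP [j /andP [/eqP]]; by exists j.
pose s := one_line w; pose l := take d.+1 s; pose r := drop d.+1 s.
have d1n : d.+1 < n by rewrite -d1E.
have size_l : size l = d.+1 by rewrite size_take size_one_line d1n.
have asc i : i.+1 < n -> i != d -> nth 0 s i < nth 0 s i.+1.
  move=> iN id; have iN' := ltnW iN.
  rewrite (nth_one_line w (Ordinal iN')) (nth_one_line w (Ordinal iN)) ltnS.
  rewrite ltn_neqAle; apply/andP; split.
    by apply/negP => /eqP/val_inj/perm_inj/(congr1 val) /=; lia.
  rewrite leqNgt -(@descentP _ _ (Ordinal iN')) // dE in_set1.
  by apply: contra id => /eqP <-.
have sl : sorted ltn l.
  apply/(sortedP 0) => i; rewrite size_l => id; rewrite !nth_take //; last exact: ltnW.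
  by apply: asc; lia.
have sr : sorted ltn r.
  apply/(sortedP 0) => i; rewrite size_drop size_one_line => id.
  by rewrite !nth_drop addnS; apply: asc; lia.
have s_lr : s = l ++ r by rewrite cat_take_drop.
have [lP rP] : (forall i : 'I_n, (i.+1 \in l) = ((w^-1)%g i <= d)) /\
   (forall x, (x \in r) = (0 < x <= n) && (x \notin l)).
  have us := uniq_one_line w.
  split=> [i|x].
    have iE : i.+1 = nth 0 s ((w^-1)%g i) by rewrite nth_one_line permKV.
    rewrite in_take ?mem_one_line ?ltn_ord // iE index_uniq ?size_one_line //.
  rewrite -(mem_one_line w); move: us; rewrite -/s s_lr mem_cat cat_uniq => /and3P [_ /hasPn lr _].
  by case: (boolP (x \in r)) => [/lr /= /negPf ->|]; rewrite ?orbT ?orbF ?andbN.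
(* Some consecutive pair of values between [x] and [y] passes from outside [l] into [l]; this is a
   descent of the inverse, hence sits at [e]. *)
have trans x y : x < y -> x.+1 \notin l -> y.+1 \in l -> x <= e < y.
  move=> xy lx ly.
  have [z [xz zy lz lz1]] : exists z, [/\ x <= z, z < y, z.+1 \notin l & z.+2 \in l].
    elim: y xy ly => // y IHy; rewrite ltnS leq_eqVlt => /orP [/eqP <-|xy] ly.
      by exists x.
    have [ly'|ly'] := boolP (y.+1 \in l); last by exists y; rewrite (ltnW xy).
    by have [z [? ? ? ?]] := IHy xy ly'; exists z; split=> //; apply: ltnW.
  have z1n : z.+1 < n.
    have : z.+2 \in s by rewrite s_lr mem_cat lz1.
    by rewrite mem_one_line.
  suff -> : nat_of_ord e = z by rewrite xz zy.
  have zn := ltnW z1n.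
  suff : Ordinal zn \in [set e] by rewrite in_set1 => /eqP <-.
  rewrite -eE (@descentP _ _ _ (Ordinal z1n)) //.
  move: lz lz1; rewrite (lP (Ordinal zn)) (lP (Ordinal z1n)) -ltnNge => A B.
  exact: leq_ltn_trans B A.
(* If the values [e] and [e + 1] were in the same run, that run being increasing would place [e]
   first, contrary to the descent. *)
have [le le1] : e.+1 \notin l /\ e.+2 \in l.
  have w_nth (i : 'I_n) : i.+1 = nth 0 s ((w^-1)%g i) by rewrite nth_one_line permKV.
  move: (w_nth e) (w_nth e1); rewrite e1E -[in e.+2]e1E !lP => eN e1N.
  have [ed|ed] := leqP ((w^-1)%g e) d.
    have := sorted_ltn_nth ltn_trans 0 sl ((w^-1)%g e1) ((w^-1)%g e).
    rewrite !inE size_l !nth_take ?ltnS ?(leq_trans (ltnW we)) // -eN -e1N.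
    by move=> /(_ isT ed we); lia.
  split=> //; have [//|e1d] := leqP ((w^-1)%g e1) d.
  have := sorted_ltn_nth ltn_trans 0 sr ((w^-1)%g e1 - d.+1) ((w^-1)%g e - d.+1).
  rewrite !inE size_drop size_one_line !nth_drop !subnKC // -eN -e1N.
  have ? := ltn_ord ((w^-1)%g e1); have ? := ltn_ord ((w^-1)%g e).
  by move=> lt_e; have := lt_e ltac:(lia) ltac:(lia) ltac:(lia); lia.
have [a la a_min] := ex_minnP (ex_intro (fun x => x.+1 \notin l) (nat_of_ord e) le).
(* The out-of-range value [n] is missing from [l], so a least missing value [c] beyond [e] exists
   and is at most [n]. *)
have ln : (e < n) && (n.+1 \notin l).
  rewrite ltn_ord; apply/negP => ln.
  have : n.+1 \in s by rewrite s_lr mem_cat ln.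
  by rewrite mem_one_line ltnn.
have [c /andP [ec lc] c_min] := ex_minnP (ex_intro (fun x => (e < x) && (x.+1 \notin l)) n ln).
have ae : a <= e by apply: a_min.
have cn : c <= n by apply: c_min.
have ec1 : e.+1 < c.
  by rewrite ltn_neqAle ec andbT; apply: contraNneq lc => <-.
have lE x : (x.+1 \in l) = (x < a) || (e < x < c).
  have [xa|ax] /= := ltnP x a.
    by apply: contraLR xa => /a_min; rewrite -leqNgt.
  have [xe|ex] /= := leqP x e.
    apply/negbTE/negP => lx; have := trans _ _ _ la lx.
    by have : x != a by [apply: contraNneq la => <-]; lia.
  have [xc|cx] := ltnP x c.
    by apply: contraLR xc => lx; rewrite -leqNgt; apply: c_min; rewrite ex.
  apply/negbTE/negP => lx; have := trans _ _ _ lc lx.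
  by have : x != c by [apply: contraNneq lc => <-]; lia.
have l0 : 0 \notin l.
  by apply/negP => l0; have : 0 \in s by [rewrite s_lr mem_cat l0]; rewrite mem_one_line.
exists a, e.+1, c; rewrite /block_form ltnS ae ec1 cn /=; apply/eqP.
(* Strictly increasing lists with the same elements are equal, so each run is settled by membership
   alone. *)
rewrite -/s s_lr catA; congr (_ ++ _).
  apply: (irr_sorted_eq ltn_trans ltnn sl); first by apply: sorted_ltn_iota2; lia.
  case=> [|x]; rewrite mem_cat !mem_iota ?(negPf l0) ?lE //; lia.
apply: (irr_sorted_eq ltn_trans ltnn sr); first by apply: sorted_ltn_iota2; lia.
by case=> [|x]; rewrite rP mem_cat !mem_iota ?lE //; lia.
Qed.

Lemma bigrassmannianP n (w : 'S_n) :
  reflect (exists a b c, block_form w a b c) (bigrassmannian w).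
Proof.
apply: (iffP idP) => [/bigrassmannian_block //|[a [b [c fw]]]].
rewrite /bigrassmannian (block_form_descents fw).
by rewrite (block_form_descents (block_form_inv fw)).
Qed.

Lemma length_vector_block n (w : 'S_n) a b c : block_form w a b c ->
  length_vector w = [tuple a.+1; b - a; c - b; n.+1 - c].
Proof.
move=> fw; rewrite /length_vector; case: pickP => [[[a' b'] c'] /= fw'|].
  by have [-> -> ->] := block_form_uniq fw fw'.
have /block_formP [ab bc cn _] := fw.
have an : a < n.+1 by lia.
have bn : b < n.+1 by lia.
have cn1 : c < n.+1 by [].
by move=> /(_ (Ordinal an, Ordinal bn, Ordinal cn1)) /=; rewrite fw.
Qed.

(** * Covers *)

(* The four unit moves l + e_i - e_j with i in {2, 3} and j in {1, 4}. *)
Definition unit_step (a b c a' b' c' : nat) : bool :=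
  [|| [&& a == a'.+1, b == b' & c == c'],
      [&& a == a'.+1, b == b'.+1 & c == c'],
      [&& a' == a, b' == b.+1 & c' == c.+1] |
      [&& a' == a, b' == b & c' == c.+1]].

Lemma block_eq n (v w : 'S_n) a b c a' b' c' :
  block_form v a b c -> block_form w a' b' c' ->
  (v == w) = [&& a == a', b == b' & c == c'].
Proof.
move=> fv fw; apply/eqP/and3P => [vw|[/eqP aE /eqP bE /eqP cE]].
  by move: fw; rewrite -vw => /(block_form_uniq fv) [-> -> ->].
by apply: block_form_inj fv _; rewrite aE bE cE.
Qed.

(** A unit move leaves no room for an intermediate element. Conversely, from [v] strictly below [w]
    some unit move stays below [w], so a cover must be that move. *)
Lemma block_coversP n (v w : 'S_n) a b c a' b' c' :
  block_form v a b c -> block_form w a' b' c' ->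
  bg_covers v w = unit_step a b c a' b' c'.
Proof.
move=> fv fw; have /block_formP [ab bc cn _] := fv.
have /block_formP [ab' bc' cn' _] := fw.
have gv : bigrassmannian v by apply/bigrassmannianP; exists a, b, c.
have gw : bigrassmannian w by apply/bigrassmannianP; exists a', b', c'.
rewrite /bg_covers gv gw /= /bruhat_lt (block_eq fv fw) (block_leP fv fw).
apply/andP/idP => [[/andP [neq_vw le_vw] no_q]|step]; last first.
  split; first by move: step; rewrite /unit_step; lia.
  apply/existsPn => q; apply/negP => /and3P [/bigrassmannianP [x [y [z fq]]]].
  rewrite (block_eq fv fq) (block_leP fv fq) (block_eq fq fw) (block_leP fq fw).
  by have /block_formP [xy yz _ _] := fq; move: step; rewrite /unit_step; lia.
apply: contraNT no_q => nstep.
(* Shrink [l_1] if it must still decrease, otherwise [l_4]; enlarge [l_2] if it has room, otherwise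
   [l_3], which then has room because the lengths have a fixed sum. *)
have [x [y [z [xyz vxyz]]]] : exists x y z, [&& x < y, y < z & z <= n] /\
    [&& unit_step a b c x y z, a' <= x, z <= c', y - x <= b' - a' & z - y <= c' - b'].
  have [lt_a|le_a] := ltnP a' a.
    have [lt_2|le_2] := ltnP (b - a) (b' - a').
      by exists a.-1, b, c; rewrite /unit_step; split; lia.
    by exists a.-1, b.-1, c; rewrite /unit_step; split; lia.
  have [lt_2|le_2] := ltnP (b - a) (b' - a').
    by exists a, b.+1, c.+1; rewrite /unit_step; split; lia.
  by exists a, b, c.+1; rewrite /unit_step; split; lia.
have /and3P [xy yz zn] := xyz; have [q fq] := ex_block_form xy yz zn.
apply/existsP; exists q; apply/and3P; split.
- by apply/bigrassmannianP; exists x, y, z.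
- rewrite (block_eq fv fq) (block_leP fv fq).
  by move: vxyz; rewrite /unit_step; lia.
rewrite (block_eq fq fw) (block_leP fq fw); have /and5P [step -> -> -> ->] := vxyz.
rewrite !andbT; apply/negP => /and3P [/eqP xE /eqP yE /eqP zE].
by move: nstep; rewrite -xE -yE -zE step.
Qed.

Lemma bg_rank_block n (w : 'S_n) a b c : block_form w a b c -> bg_rank w = c - a - 2.
Proof.
move=> fw; rewrite /bg_rank /ell (length_vector_block fw) /=.
have /block_formP [ab bc _ _] := fw.
by rewrite [_ + _](_ : _ = c - a) //= /tnth /=; lia.
Qed.

(** The rank equalities demanded of a butterfly thus follow from its covers. *)
Lemma bg_rank_covers n (v w : 'S_n) : bg_covers v w -> bg_rank w = (bg_rank v).+1.
Proof.
move=> cov; have /and4P [gv gw _ _] := cov.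
have /bigrassmannianP [a [b [c fv]]] := gv; have /bigrassmannianP [x [y [z fw]]] := gw.
move: cov; rewrite (block_coversP fv fw) (bg_rank_block fv) (bg_rank_block fw).
have /block_formP [ab bc _ _] := fv; have /block_formP [xy yz _ _] := fw.
by rewrite /unit_step; lia.
Qed.

(** * Butterflies *)

(** The identity is a default for invalid triples; it makes the butterflies total functions of three
    natural numbers. *)
Definition block_perm n a b c : 'S_n := odflt 1%g [pick w | block_form w a b c].

Lemma block_permP n a b c : a < b -> b < c -> c <= n ->
  block_form (block_perm n a b c) a b c.
Proof.
move=> ab bc cn; rewrite /block_perm; case: pickP => //= no_w.
by have [w] := ex_block_form ab bc cn; rewrite no_w.
Qed.

Lemma block_perm_eq n (w : 'S_n) a b c x y z : block_form w a b c ->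
  [&& x < y, y < z & z <= n] ->
  (w == block_perm n x y z) = [&& a == x, b == y & c == z].
Proof. by move=> fw /and3P [xy yz zn]; apply: block_eq fw (block_permP xy yz zn). Qed.

(* The sets {m + e_1, ..., m + e_4}, where m = (x + 1, y - x, z - y, n - z). *)
Definition lower_butterfly n x y z : {set 'S_n} :=
  [set block_perm n x.+1 y.+1 z.+1; block_perm n x y z;
       block_perm n x y.+1 z.+1; block_perm n x y z.+1].

(* The sets {m + (1,1,1,1) - e_i | i = 1, ..., 4}, where
   m = (x + 1, y - x, z - y, n - 2 - z). *)
Definition upper_butterfly n x y z : {set 'S_n} :=
  [set block_perm n x.+1 y.+1 z.+2; block_perm n x.+1 y.+2 z.+2;
       block_perm n x y.+1 z.+2; block_perm n x.+1 y.+2 z.+3].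

Lemma mem_lower n (w : 'S_n) a b c x y z : block_form w a b c ->
  [&& x < y, y < z & z < n] ->
  (w \in lower_butterfly n x y z) =
  [|| [&& a == x.+1, b == y.+1 & c == z.+1], [&& a == x, b == y & c == z],
      [&& a == x, b == y.+1 & c == z.+1] | [&& a == x, b == y & c == z.+1]].
Proof.
move=> fw /and3P [xy yz zn]; rewrite !inE !(block_perm_eq fw); lia.
Qed.

Lemma mem_upper n (w : 'S_n) a b c x y z : block_form w a b c ->
  [&& x < y, y < z & z < n - 2] ->
  (w \in upper_butterfly n x y z) =
  [|| [&& a == x.+1, b == y.+1 & c == z.+2], [&& a == x.+1, b == y.+2 & c == z.+2],
      [&& a == x, b == y.+1 & c == z.+2] | [&& a == x.+1, b == y.+2 & c == z.+3]].
Proof.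
move=> fw /and3P [xy yz zn]; rewrite !inE !(block_perm_eq fw); lia.
Qed.

Lemma butterfly_intro n (p1 p2 s1 s2 : 'S_n) :
  p1 != p2 -> s1 != s2 -> bg_covers p1 s1 -> bg_covers p1 s2 ->
  bg_covers p2 s1 -> bg_covers p2 s2 -> butterfly [set p1; p2; s1; s2].
Proof.
move=> n12 n34 c11 c12 c21 c22.
apply/existsP; exists p1; apply/existsP; exists p2.
apply/existsP; exists s1; apply/existsP; exists s2.
rewrite eqxx c11 c12 c21 c22 (bg_rank_covers c12) (bg_rank_covers c11) eqxx /= !andbT.
have ne p s : bg_covers p s -> p != s.
  by case/and4P => _ _ /andP [].
rewrite !inE !negb_or n12 n34 !ne // !andTb.
by rewrite -eqSS -(bg_rank_covers c11) -(bg_rank_covers c21) eqxx.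
Qed.

(** The bit [i] tells whether [l_2] or [l_3] grows, and [j] whether [l_1] or [l_4] shrinks (true
    meaning the first of each pair). *)
Lemma unit_stepP a b c a' b' c' : unit_step a b c a' b' c' ->
  exists i j : bool, [/\ a = a' + j, b' + j = b + i & c' = c + ~~ j].
Proof.
case/or4P => /and3P [/eqP -> /eqP -> /eqP ->].
- by exists true, true; rewrite addn0 addn1.
- by exists false, true; rewrite !addn0 !addn1.
- by exists true, false; rewrite !addn0 !addn1.
- by exists false, false; rewrite !addn0 !addn1.
Qed.

Lemma lower_square n (p1 p2 s1 s2 : 'S_n) x y z :
  block_form p1 x.+1 y.+1 z.+1 -> block_form p2 x y z ->
  block_form s1 x y.+1 z.+1 -> block_form s2 x y z.+1 ->
  [&& x < y, y < z & z < n] /\ [set p1; p2; s1; s2] = lower_butterfly n x y z.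
Proof.
move=> f1 f2 f3 f4; have /block_formP [? ? ? _] := f1; have /block_formP [? ? _ _] := f2.
by split; [lia | congr ([set _; _; _; _]);
  [apply: block_form_inj f1 _ | apply: block_form_inj f2 _ |
   apply: block_form_inj f3 _ | apply: block_form_inj f4 _]; apply: block_permP; lia].
Qed.

Lemma upper_square n (p1 p2 s1 s2 : 'S_n) x y z :
  block_form p1 x.+1 y.+1 z.+2 -> block_form p2 x.+1 y.+2 z.+2 ->
  block_form s1 x y.+1 z.+2 -> block_form s2 x.+1 y.+2 z.+3 ->
  [&& x < y, y < z & z < n - 2] /\ [set p1; p2; s1; s2] = upper_butterfly n x y z.
Proof.
move=> f1 f2 f3 f4; have /block_formP [? ? ? _] := f1; have /block_formP [? ? _ _] := f2.
have /block_formP [? ? ? _] := f4.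
by split; [lia | congr ([set _; _; _; _]);
  [apply: block_form_inj f1 _ | apply: block_form_inj f2 _ |
   apply: block_form_inj f3 _ | apply: block_form_inj f4 _]; apply: block_permP; lia].
Qed.

(** The pairs encode the moves [p1] to [s1], [p1] to [s2], [p2] to [s1] and [p2] to [s2]. Opposite
    moves have equal sums, which forces the four moves to be distinct. Either the moves out of [p1]
    share the growing coordinate (upper butterfly), or they share the shrinking one (lower
    butterfly). *)
Lemma unit_vector_square (i j k l x y z w : bool) :
  i + z = k + x -> j + w = l + y -> (i, j) <> (k, l) -> (i, j) <> (x, y) ->
  [/\ k = i, l = ~~ j, x = ~~ i, y = j & z = ~~ i] /\ w = ~~ j \/
  [/\ k = ~~ i, l = j, x = i, y = ~~ j & z = ~~ i] /\ w = ~~ j.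
Proof.
by case: i; case: j; case: k; case: l => //; case: x; case: y => //; case: z; case: w => //;
   try (by left); by right.
Qed.

Lemma butterfly_cases n (p1 p2 s1 s2 : 'S_n) :
  p1 != p2 -> s1 != s2 -> bg_covers p1 s1 -> bg_covers p1 s2 ->
  bg_covers p2 s1 -> bg_covers p2 s2 -> exists x y z,
  [&& x < y, y < z & z < n] /\ [set p1; p2; s1; s2] = lower_butterfly n x y z \/
  [&& x < y, y < z & z < n - 2] /\ [set p1; p2; s1; s2] = upper_butterfly n x y z.
Proof.
move=> n12 n34 c11 c12 c21 c22.
have /and4P [/bigrassmannianP [a1 [b1 [c1 f1]]] /bigrassmannianP [a3 [b3 [c3 f3]]] _ _] := c11.
have /and4P [/bigrassmannianP [a2 [b2 [c2 f2]]] /bigrassmannianP [a4 [b4 [c4 f4]]] _ _] := c22.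
have swap_p : [set p1; p2; s1; s2] = [set p2; p1; s1; s2].
  by rewrite (setUC [set p1]).
have swap_s p p' : [set p; p'; s1; s2] = [set p; p'; s2; s1].
  by rewrite -!setUA (setUC [set s1]).
move: c11 c12 c21 c22 n12 n34.
rewrite (block_coversP f1 f3) (block_coversP f1 f4) (block_coversP f2 f3).
rewrite (block_coversP f2 f4) (block_eq f1 f2) (block_eq f3 f4).
move=> /unit_stepP [i [j [E1 E2 E3]]] /unit_stepP [k [l [F1 F2 F3]]].
move=> /unit_stepP [x [y [G1 G2 G3]]] /unit_stepP [z [w [H1 H2 H3]]] n12 n34.
(* Equal moves out of [p1] would give [s1 = s2]; below, equal moves into [s1] would give
   [p1 = p2]. *)
have {n34} nij : (i, j) <> (k, l).
  case=> ik jl; move: n34; rewrite -(eqn_add2r j) -E1 F1 -jl eqxx.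
  by rewrite -(eqn_add2r j b3) E2 ik jl F2 eqxx E3 F3 jl eqxx.
have {n12} nxy : (i, j) <> (x, y).
  case=> ix jy; move: n12; rewrite E1 G1 jy eqxx -(eqn_add2r i) -E2 ix -G2 jy eqxx.
  by rewrite -(eqn_add2r (~~ y)) -G3 -[in c1 + _]jy -E3 eqxx.
have e_j : j + w = l + y by clear -E1 F1 G1 H1; lia.
have e_i : i + z = k + x by clear -E2 F2 G2 H2 e_j; lia.
have cast (p : 'S_n) a b c a' b' c' : block_form p a b c -> a = a' -> b = b' -> c = c' ->
  block_form p a' b' c' by move=> ? <- <- <-.
have /block_formP [lab1 lbc1 _ _] := f1.
have /block_formP [lab2 lbc2 _ _] := f2.
have [[[kE lE xE yE zE] wE]|[[kE lE xE yE zE] wE]] := unit_vector_square e_i e_j nij nxy.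
  (* Taking minima makes the witnesses independent of the order within each pair, so the four bit
     cases differ only by swapping [p1] with [p2] or [s1] with [s2]. *)
  exists (minn a3 a4), (minn b1 b2).-1, c1.-2; right; subst k l x y z w.
  move: {e_i e_j nij nxy} E1 E2 E3 F1 F2 F3 G1 G2 G3 H1 H2 H3.
  case: i; case: j; rewrite /= ?addn0 ?addn1 => E1 E2 E3 F1 F2 F3 G1 G2 G3 H1 H2 H3;
    [ | rewrite swap_s | rewrite swap_p | rewrite swap_p swap_s]; apply: upper_square;
    first [apply: (cast _ _ _ _ _ _ _ f1) | apply: (cast _ _ _ _ _ _ _ f2) |
           apply: (cast _ _ _ _ _ _ _ f3) | apply: (cast _ _ _ _ _ _ _ f4)];
    clear swap_p swap_s cast f1 f2 f3 f4; lia.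
exists (minn a3 a4), (minn b3 b4), (minn c1 c2); left; subst k l x y z w.
move: {e_i e_j nij nxy} E1 E2 E3 F1 F2 F3 G1 G2 G3 H1 H2 H3.
case: i; case: j; rewrite /= ?addn0 ?addn1 => E1 E2 E3 F1 F2 F3 G1 G2 G3 H1 H2 H3;
  [ | rewrite swap_p | rewrite swap_s | rewrite swap_p swap_s]; apply: lower_square;
  first [apply: (cast _ _ _ _ _ _ _ f1) | apply: (cast _ _ _ _ _ _ _ f2) |
         apply: (cast _ _ _ _ _ _ _ f3) | apply: (cast _ _ _ _ _ _ _ f4)];
  clear swap_p swap_s cast f1 f2 f3 f4; lia.
Qed.

(** * Counting butterflies by increasing triples *)

Definition triple_family (T : finType) (F : nat -> nat -> nat -> T) N : {set T} :=
  [set F (tnth t ord0) (tnth t (lift ord0 ord0)) (tnth t ord_max)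
     | t : 3.-tuple 'I_N in [set t : 3.-tuple 'I_N | sorted ltn (map val t)]].

Lemma triple_familyP (T : finType) (F : nat -> nat -> nat -> T) N B :
  reflect (exists x y z, [&& x < y, y < z & z < N] /\ B = F x y z)
          (B \in triple_family F N).
Proof.
apply: (iffP imsetP) => [[t]|[x [y [z [/and3P [xy yz zN] ->]]]]].
  case: t => [[|x [|y [|z []]]] tP] //; rewrite inE /= andbT => /andP [xy yz] ->.
  by exists x, y, z; rewrite xy yz ltn_ord.
have yN := ltn_trans yz zN; have xN := ltn_trans xy yN.
exists [tuple Ordinal xN; Ordinal yN; Ordinal zN] => //.
by rewrite inE /= xy yz.
Qed.

(** Strictly increasing tuples are counted by binomial coefficients. At [N = n - 2] the truncated
    subtraction agrees with the convention that the coefficient vanishes for small [n]. *)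
Lemma card_triple_family (T : finType) (F : nat -> nat -> nat -> T) N :
  (forall x y z x' y' z', [&& x < y, y < z & z < N] -> [&& x' < y', y' < z' & z' < N] ->
     F x y z = F x' y' z' -> [/\ x = x', y = y' & z = z']) ->
  #|triple_family F N| = 'C(N, 3).
Proof.
move=> F_inj; rewrite card_in_imset ?card_ltn_sorted_tuples // => t u.
case: t => [[|x [|y [|z []]]] tP] //; case: u => [[|x' [|y' [|z' []]]] uP] //.
rewrite !inE /= !andbT => /andP [xy yz] /andP [xy' yz'].
rewrite !(tnth_nth x) /= => /F_inj; rewrite xy yz xy' yz' !ltn_ord.
move=> /(_ isT isT) [/val_inj xE /val_inj yE /val_inj zE].
by apply: val_inj; rewrite /= xE yE zE.
Qed.

Lemma lower_butterflyP n x y z : [&& x < y, y < z & z < n] ->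
  butterfly (lower_butterfly n x y z).
Proof.
move=> /and3P [xy yz zn].
have f1 : block_form (block_perm n x.+1 y.+1 z.+1) x.+1 y.+1 z.+1 by apply: block_permP.
have f2 : block_form (block_perm n x y z) x y z by apply: block_permP; lia.
have f3 : block_form (block_perm n x y.+1 z.+1) x y.+1 z.+1 by apply: block_permP; lia.
have f4 : block_form (block_perm n x y z.+1) x y z.+1 by apply: block_permP; lia.
apply: butterfly_intro; rewrite ?(block_eq f1 f2) ?(block_eq f3 f4);
  rewrite ?(block_coversP f1 f3) ?(block_coversP f1 f4);
  rewrite ?(block_coversP f2 f3) ?(block_coversP f2 f4) /unit_step; clear; lia.
Qed.

Lemma upper_butterflyP n x y z : [&& x < y, y < z & z < n - 2] ->
  butterfly (upper_butterfly n x y z).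
Proof.
move=> /and3P [xy yz zn].
have f1 : block_form (block_perm n x.+1 y.+1 z.+2) x.+1 y.+1 z.+2 by apply: block_permP; lia.
have f2 : block_form (block_perm n x.+1 y.+2 z.+2) x.+1 y.+2 z.+2 by apply: block_permP; lia.
have f3 : block_form (block_perm n x y.+1 z.+2) x y.+1 z.+2 by apply: block_permP; lia.
have f4 : block_form (block_perm n x.+1 y.+2 z.+3) x.+1 y.+2 z.+3 by apply: block_permP; lia.
apply: butterfly_intro; rewrite ?(block_eq f1 f2) ?(block_eq f3 f4);
  rewrite ?(block_coversP f1 f3) ?(block_coversP f1 f4);
  rewrite ?(block_coversP f2 f3) ?(block_coversP f2 f4) /unit_step; clear; lia.
Qed.

Lemma butterfliesE n : butterflies n =
  triple_family (lower_butterfly n) n :|: triple_family (upper_butterfly n) (n - 2).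
Proof.
apply/setP => B; rewrite in_setU inE; apply/idP/orP.
  case/existsP => p1 /existsP [p2 /existsP [s1 /existsP [s2]]].
  case/andP => /eqP -> /andP [uniq_ps /and3P [_ _ /and5P [_ c11 c12 c21 c22]]].
  have [n12 n34] : p1 != p2 /\ s1 != s2.
    by split; apply: contraTneq uniq_ps => ->; rewrite /= !inE eqxx ?orbT ?andbF.
  have [x [y [z]]] := butterfly_cases n12 n34 c11 c12 c21 c22.
  by case=> xyz; [left|right]; apply/triple_familyP; exists x, y, z.
case=> /triple_familyP [x [y [z [xyz ->]]]].
  exact: lower_butterflyP.
exact: upper_butterflyP.
Qed.

(** * Butterflies through a given edge *)

(** Two distinct vectors [m + e_i] and [m + e_j] have coordinatewise minimum [m]. Here [l_1] and
    [l_4] are smallest at [w], while [l_2] and [l_3] are smallest at [v]; the right-hand side solves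
    for the parameters. *)
Lemma lower_edge n (v w : 'S_n) a b c a' b' c' x y z :
  block_form v a b c -> block_form w a' b' c' -> unit_step a b c a' b' c' ->
  [&& x < y, y < z & z < n] ->
  (v \in lower_butterfly n x y z) && (w \in lower_butterfly n x y z) =
  [&& x == a', y == a' + (b - a) & z == c'.-1].
Proof.
move=> fv fw step xyz; rewrite (mem_lower fv xyz) (mem_lower fw xyz).
have /block_formP [ab bc cn _] := fv; have /block_formP [ab' bc' cn' _] := fw.
clear fv fw; case/or4P: step => /and3P [/eqP aE /eqP bE /eqP cE]; subst;
  (apply/andP/and3P => [[]|[/eqP xE /eqP yE /eqP zE]]; last by split; lia);
  move=> /or4P [] /and3P [/eqP e1 /eqP e2 /eqP e3] /or4P [] /and3P [/eqP e4 /eqP e5 /eqP e6];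
  by split; lia.
Qed.

(** Dually, the coordinatewise maximum of the two length vectors is [m + (1,1,1,1)], with [l_1] and
    [l_4] taken from [v] and [l_2] and [l_3] from [w]. *)
Lemma upper_edge n (v w : 'S_n) a b c a' b' c' x y z :
  block_form v a b c -> block_form w a' b' c' -> unit_step a b c a' b' c' ->
  [&& x < y, y < z & z < n - 2] ->
  (v \in upper_butterfly n x y z) && (w \in upper_butterfly n x y z) =
  [&& x.+1 == a, y.+2 == a + (b' - a') & z.+2 == c].
Proof.
move=> fv fw step xyz; rewrite (mem_upper fv xyz) (mem_upper fw xyz).
have /block_formP [ab bc cn _] := fv; have /block_formP [ab' bc' cn' _] := fw.
clear fv fw; case/or4P: step => /and3P [/eqP aE /eqP bE /eqP cE]; subst;
  (apply/andP/and3P => [[]|[/eqP xE /eqP yE /eqP zE]]; last by split; lia);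
  move=> /or4P [] /and3P [/eqP e1 /eqP e2 /eqP e3] /or4P [] /and3P [/eqP e4 /eqP e5 /eqP e6];
  by split; lia.
Qed.

(** A single edge inside the butterfly already determines its parameters, by [lower_edge]. *)
Lemma lower_inj n x y z x' y' z' :
  [&& x < y, y < z & z < n] -> [&& x' < y', y' < z' & z' < n] ->
  lower_butterfly n x y z = lower_butterfly n x' y' z' -> [/\ x = x', y = y' & z = z'].
Proof.
move=> xyz xyz' eqB; have /and3P [xy yz zn] := xyz.
have f1 : block_form (block_perm n x y z) x y z by apply: block_permP; lia.
have f2 : block_form (block_perm n x y z.+1) x y z.+1 by apply: block_permP; lia.
have step : unit_step x y z x y z.+1 by rewrite /unit_step !eqxx !orbT.
have := lower_edge f1 f2 step xyz'; rewrite -eqB (lower_edge f1 f2 step xyz).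
by clear - xy => eqs; split; lia.
Qed.

Lemma upper_inj n x y z x' y' z' :
  [&& x < y, y < z & z < n - 2] -> [&& x' < y', y' < z' & z' < n - 2] ->
  upper_butterfly n x y z = upper_butterfly n x' y' z' -> [/\ x = x', y = y' & z = z'].
Proof.
move=> xyz xyz' eqB; have /and3P [xy yz zn] := xyz.
have f1 : block_form (block_perm n x.+1 y.+1 z.+2) x.+1 y.+1 z.+2 by apply: block_permP; lia.
have f2 : block_form (block_perm n x y.+1 z.+2) x y.+1 z.+2 by apply: block_permP; lia.
have step : unit_step x.+1 y.+1 z.+2 x y.+1 z.+2 by rewrite /unit_step !eqxx.
have := upper_edge f1 f2 step xyz'; rewrite -eqB (upper_edge f1 f2 step xyz).
by clear - xy yz => eqs; split; lia.
Qed.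

(** An upper butterfly containing [m + e_4] and [m + e_3] is bounded coordinatewise by
    [m + e_3 + e_4], so it cannot contain [m + e_2]. *)
Lemma lower_neq_upper n x y z x' y' z' :
  [&& x < y, y < z & z < n] -> [&& x' < y', y' < z' & z' < n - 2] ->
  lower_butterfly n x y z <> upper_butterfly n x' y' z'.
Proof.
move=> xyz xyz' eqB; have /and3P [xy yz zn] := xyz.
have f1 : block_form (block_perm n x y z) x y z by apply: block_permP; lia.
have f2 : block_form (block_perm n x y z.+1) x y z.+1 by apply: block_permP; lia.
have f3 : block_form (block_perm n x y.+1 z.+1) x y.+1 z.+1 by apply: block_permP; lia.
have step : unit_step x y z x y z.+1 by rewrite /unit_step !eqxx !orbT.
have := upper_edge f1 f2 step xyz'; have := mem_upper f3 xyz'.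
rewrite -eqB (mem_lower f3 xyz) (lower_edge f1 f2 step xyz).
by clear - xy; lia.
Qed.

Lemma card_butterflies n : #|butterflies n| = 'C(n, 3) + 'C(n - 2, 3).
Proof.
rewrite butterfliesE cardsU (_ : _ :&: _ = set0) ?cards0 ?subn0; last first.
  apply/setP => B; rewrite in_setI in_set0; apply/negP => /andP [/triple_familyP lowB].
  have [x [y [z [xyz ->]]]] := lowB.
  by case/triple_familyP => x' [y' [z' [xyz' /(lower_neq_upper xyz xyz')]]].
rewrite (card_triple_family (@lower_inj n)) card_triple_family // => *.
exact: (@upper_inj n).
Qed.

(** The boolean test says that every coordinate of the maximum of the two length vectors is at least
    2, which is what the upper butterfly needs to exist. *)
Lemma edge_butterfliesE n (v w : 'S_n) a b c a' b' c' :
  block_form v a b c -> block_form w a' b' c' -> unit_step a b c a' b' c' ->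
  edge_butterflies v w =
    lower_butterfly n a' (a' + (b - a)) c'.-1 |:
    (if [&& 0 < a, 1 < b' - a', 1 < c' - b' & c < n]
     then [set upper_butterfly n a.-1 (a + (b' - a') - 2) (c - 2)] else set0).
Proof.
move=> fv fw step.
have /block_formP [ab bc cn _] := fv; have /block_formP [ab' bc' cn' _] := fw.
have low_ok : [&& a' < a' + (b - a), a' + (b - a) < c'.-1 & c'.-1 < n].
  by clear fv fw; move: step; rewrite /unit_step; lia.
have up_ok : [&& 0 < a, 1 < b' - a', 1 < c' - b' & c < n] ->
    [&& a.-1 < a + (b' - a') - 2, a + (b' - a') - 2 < c - 2 & c - 2 < n - 2].
  by clear fv fw; move: step; rewrite /unit_step; lia.
apply/setP => B; rewrite inE butterfliesE in_setU in_setU1.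
apply/andP/orP => [[/orP [] /triple_familyP [x [y [z [xyz ->]]]]]|].
- by rewrite (lower_edge fv fw step xyz) => /and3P [/eqP-> /eqP-> /eqP->]; left.
- rewrite (upper_edge fv fw step xyz) => /and3P [/eqP xE /eqP yE /eqP zE]; right.
  have -> : [&& 0 < a, 1 < b' - a', 1 < c' - b' & c < n].
    by clear fv fw up_ok low_ok; move: step xyz; rewrite /unit_step; lia.
  by rewrite in_set1 -yE -xE -zE !subn2.
case=> [/eqP ->|].
  rewrite (lower_edge fv fw step low_ok) !eqxx; split=> //; apply/orP; left.
  by apply/triple_familyP; exists a', (a' + (b - a)), c'.-1.
case: ifP => [cond|_]; rewrite ?inE // => /eqP ->.
have ok := up_ok cond; split.
  by apply/orP; right; apply/triple_familyP; do 3 eexists; split; first exact: ok.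
by rewrite (upper_edge fv fw step ok); clear - ab bc cond; lia.
Qed.

(** All lengths are positive, so a coordinate of the maximum equals 1 exactly when both entries
    do. *)
Lemma ell_common_oneP n (v w : 'S_n) a b c a' b' c' :
  block_form v a b c -> block_form w a' b' c' -> unit_step a b c a' b' c' ->
  (exists i : 'I_4, ell v i = 1 /\ ell w i = 1) <->
  ~~ [&& 0 < a, 1 < b' - a', 1 < c' - b' & c < n].
Proof.
move=> fv fw; have /block_formP [ab bc cn _] := fv; have /block_formP [ab' bc' cn' _] := fw.
rewrite /ell (length_vector_block fv) (length_vector_block fw) /unit_step => step.
clear fv fw; split=> [[[[|[|[|[|//]]]] i4]]|nb]; rewrite ?(tnth_nth 0) /=; try lia.
have : [|| a == 0, b' - a' == 1, c' - b' == 1 | c == n] by lia.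
case/or4P => /eqP E.
- by exists (@Ordinal 4 0 isT); rewrite !(tnth_nth 0) /=; lia.
- by exists (@Ordinal 4 1 isT); rewrite !(tnth_nth 0) /=; lia.
- by exists (@Ordinal 4 2 isT); rewrite !(tnth_nth 0) /=; lia.
- by exists (@Ordinal 4 3 isT); rewrite !(tnth_nth 0) /=; lia.
Qed.

Theorem theorem3p6 (n : nat) (hn : 1 <= n) :
  #|butterflies n| = 'C(n, 3) + 'C(n - 2, 3) /\
  (forall p s : 'S_n, bg_covers p s ->
     (#|edge_butterflies p s| = 1 \/ #|edge_butterflies p s| = 2) /\
     (#|edge_butterflies p s| = 1 <->
        exists i : 'I_4, ell p i = 1 /\ ell s i = 1)).
Proof.
split=> [|p s cov]; first exact: card_butterflies.
have /and4P [gp gs _ _] := cov.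
have /bigrassmannianP [a [b [c fp]]] := gp; have /bigrassmannianP [a' [b' [c' fs]]] := gs.
have step : unit_step a b c a' b' c' by rewrite -(block_coversP fp fs).
rewrite (ell_common_oneP fp fs step) (edge_butterfliesE fp fs step).
case: ifP => cond; last by rewrite setU0 cards1; split=> //; left.
rewrite cards2 (_ : _ != _ = true); first by split=> //; right.
apply/eqP; have /block_formP [ab bc cn _] := fp; have /block_formP [ab' bc' cn' _] := fs.
by apply: lower_neq_upper; clear -step cond ab bc cn ab' bc' cn';
  move: step; rewrite /unit_step; lia.
Qed.
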